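(* For positive integers $a,b$ let $(f_{a,b}[n])_{n\ge 1}$ be defined by $f_{a,b}[1]=f_{a,b}[2]=1$ and $f_{a,b}[n]=a f_{a,b}[n-1]+b f_{a,b}[n-2]$ for $n\ge 3$, and for each positive integer $N$ let $\underline{X}_{a,b,N}$ be a random variable with values in $\{1,\dots,N\}$ and $P(\underline{X}_{a,b,N}=n)=\dfrac{f_{a,b}[N+1-n]}{\sum_{k=1}^{N}f_{a,b}[k]}$ for $1\le n\le N$. Then $$\max_{a,b\in\mathbb{N}}\ \lim_{N\to\infty}E(\underline{X}_{a,b,N})=\lim_{N\to\infty}E(\underline{X}_{1,1,N})=\varphi+1,$$ where $\varphi=\frac{1+\sqrt5}{2}$.
   Context: $\mathbb{N}$ is the set of positive integers and $E$ denotes expectation. The case $a=b=1$ is the classical Fibonacci sequence. *)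

(* Defs.v *)
From HB Require Import structures.
From mathcomp Require Import all_boot all_order all_algebra.
From mathcomp Require Import all_classical all_reals all_analysis.
Set Implicit Arguments.
Unset Strict Implicit.
Unset Printing Implicit Defensive.
Import Order.TTheory GRing.Theory Num.Theory.
Import numFieldNormedType.Exports.
Local Open Scope classical_set_scope.
Local Open Scope ring_scope.

(* Indexed from 1; the value at 0 is a placeholder (note that extending the
   recurrence backwards would not give 0 there unless a = 1). *)
Fixpoint fibab (a b n : nat) : nat :=
  match n with
  | 0 => 0
  | n'.+1 => match n' with
             | 0 => 1
             | n''.+1 => if n'' is 0 then 1
                         else a * fibab a b n' + b * fibab a b n''
             end
  end%N.

Definition inverse_fib_rv (R : realType) (a b N : nat) (d : measure_display)
    (T : measurableType d) (P : probability T R) (X : {RV P >-> R}) : Prop :=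
  (forall t : T, exists2 n : nat, (1 <= n <= N)%N & X t = n%:R) /\
  (forall n : nat, (1 <= n <= N)%N ->
     P (X @^-1` [set n%:R]) =
       ((fibab a b (N.+1 - n))%:R /
        (\sum_(1 <= k < N.+1) fibab a b k)%N%:R)%:E).

Definition is_maximum (d : Order.disp_t) (T : porderType d) (A : set T)
    (m : T) : Prop := A m /\ ubound A m.

Definition golden_ratio (R : realType) : R := (1 + Num.sqrt 5) / 2.

(* Main.v *)
Require Import Defs.
From mathcomp Require Import all_boot all_order all_algebra.
From mathcomp Require Import all_classical all_reals all_analysis.
From mathcomp Require Import measurable_realfun.
From mathcomp Require Import ring lra zify.

(* Writing S_N for the sum of f[1], ..., f[N] and T_N for that of S_1, ..., S_N,
   a summation by parts gives E(X_N) = T_N / S_N.  Summing the recurrence once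
   and twice expresses (a + b - 1) S_N through f[N+1], f[N] and
   (a + b - 1) T_N through S_{N+1}, S_N, N.  If r > 1 is the dominant root of
   x^2 = a x + b, then f[N+1] / f[N] tends to r, hence so does S_{N+1} / S_N,
   and E(X_N) tends to (r + b) / (a + b - 1) = r / (r - 1).  This is decreasing
   in r, and r is smallest for a = b = 1, where it is the golden ratio. *)

Set Implicit Arguments.
Unset Strict Implicit.
Unset Printing Implicit Defensive.
Import Order.TTheory GRing.Theory Num.Theory.
Import numFieldNormedType.Exports.
Local Open Scope classical_set_scope.
Local Open Scope ring_scope.

(** * Exact identities for the iterated partial sums *)

Definition fibab_sum (a b N : nat) : nat := (\sum_(1 <= k < N.+1) fibab a b k)%N.

Lemma fibab_sumS a b N :
  fibab_sum a b N.+1 = (fibab_sum a b N + fibab a b N.+1)%N.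
Proof. by rewrite /fibab_sum big_nat_recr. Qed.

Definition fibab_sum2 (a b N : nat) : nat :=
  (\sum_(1 <= k < N.+1) fibab_sum a b k)%N.

Lemma fibab_sum2S a b N :
  fibab_sum2 a b N.+1 = (fibab_sum2 a b N + fibab_sum a b N.+1)%N.
Proof. by rewrite /fibab_sum2 big_nat_recr. Qed.

Lemma fibabSSS a b n :
  fibab a b n.+3 = (a * fibab a b n.+2 + b * fibab a b n.+1)%N.
Proof. by []. Qed.

(** The term f[j] carries the weight N + 1 - j, which is the number of sums among S_1, ..., S_N that
    contain it. This is the summation by parts behind the numerator of the expectation. *)
Lemma fibab_weighted_sum a b N :
  (\sum_(1 <= n < N.+1) n * fibab a b (N.+1 - n))%N = fibab_sum2 a b N.
Proof.
elim: N => [|N IHN]; first by rewrite /fibab_sum2 !big_geq.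
rewrite fibab_sum2S -IHN big_nat_recl // mul1n subSS subn0.
rewrite (eq_bigr (fun i => fibab a b (N.+1 - i) + i * fibab a b (N.+1 - i))%N);
  last by move=> i _; rewrite subSS mulSn.
rewrite big_split /= addnA [RHS]addnC; congr addn.
rewrite fibab_sumS addnC; congr addn.
by rewrite /fibab_sum [RHS]big_nat_rev.
Qed.

(** Sum f[k] = a f[k-1] + b f[k-2] over k = 3, ..., n + 2. The constants 2 and a are the boundary
    terms f[1] + f[2] and a f[1]; all terms are placed so that no truncated subtraction occurs. *)
Lemma fibab_sumE a b n :
  ((a + b) * fibab_sum a b n.+1 + 2 =
   fibab_sum a b n.+1 + fibab a b n.+2 + b * fibab a b n.+1 + a)%N.
Proof.
elim: n => [|n IHn]; first by rewrite /fibab_sum big_nat1 /=; lia.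
by rewrite fibab_sumS fibabSSS; lia.
Qed.

(** Sum the previous identity over its index; the constant 1 is f[1], which is absent from f[2] +
    ... + f[n+2]. *)
Lemma fibab_sum2E a b n :
  ((a + b) * fibab_sum2 a b n.+1 + 2 * n.+1 + 1 =
   fibab_sum2 a b n.+1 + fibab_sum a b n.+2 + b * fibab_sum a b n.+1
   + a * n.+1)%N.
Proof.
elim: n => [|n IHn].
  by rewrite /fibab_sum2 big_nat1 !fibab_sumS /fibab_sum big_geq //=; lia.
have := fibab_sumE a b n.+1; rewrite fibab_sum2S.
rewrite [fibab_sum a b n.+3]fibab_sumS.
have := fibab_sumS a b n.+1; nia.
Qed.

(** * Elementary growth bounds *)

(** A crude bound, enough for 1 / f[n] to tend to 0; the factor 2 is forced by f[2] = 1. The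
    recurrence has order two, so the induction carries two consecutive indices. *)
Lemma fibab_linear a b n : (0 < a)%N -> (0 < b)%N -> (n <= 2 * fibab a b n)%N.
Proof.
move=> a_gt0 b_gt0.
suff: (n <= 2 * fibab a b n)%N && (n.+1 <= 2 * fibab a b n.+1)%N by case/andP.
elim: n => [//|[//|n] /andP[IH1 IH2]].
by rewrite IH2 andTb fibabSSS; nia.
Qed.

Lemma fibab_leS a b n : (0 < a)%N -> (fibab a b n <= fibab a b n.+1)%N.
Proof. by move=> a_gt0; case: n => [//|[//|n]]; rewrite fibabSSS; nia. Qed.

(** Summing the linear bound makes S_n at least quadratic, so that n / S_n tends to 0. *)
Lemma fibab_sum_quadratic a b n :
  (0 < a)%N -> (0 < b)%N -> (n * n.+1 <= 4 * fibab_sum a b n)%N.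
Proof.
move=> a_gt0 b_gt0; elim: n => [//|n IHn]; rewrite fibab_sumS.
have := @fibab_linear a b n.+1 a_gt0 b_gt0; nia.
Qed.

(** * Characteristic roots and the ratio of consecutive terms *)

(** The other root of x^2 = a x + b is a - r. Subtracting (a - r) f[n+1] from f[n+2] removes its
    contribution and leaves a geometric sequence of ratio r. *)
Lemma fibab_growing_part (R : comPzRingType) (a b : nat) (r : R) n :
  r ^+ 2 = a%:R * r + b%:R ->
  (fibab a b n.+2)%:R + (r - a%:R) * (fibab a b n.+1)%:R =
  r ^+ n * (1 + (r - a%:R)).
Proof.
move=> r_root; elim: n => [|n IHn]; first by rewrite expr0 mul1r mulr1.
rewrite fibabSSS natrD !natrM exprS -mulrA -IHn.
have -> : b%:R = r ^+ 2 - a%:R * r by rewrite r_root; ring.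
by ring.
Qed.

(** The same elimination with the roles of r and a - r exchanged. *)
Lemma fibab_decaying_part (R : comPzRingType) (a b : nat) (r : R) n :
  r ^+ 2 = a%:R * r + b%:R ->
  (fibab a b n.+2)%:R - r * (fibab a b n.+1)%:R = (a%:R - r) ^+ n * (1 - r).
Proof.
move=> r_root; elim: n => [|n IHn]; first by rewrite expr0 mul1r mulr1.
rewrite fibabSSS natrD !natrM exprS -mulrA -IHn.
have -> : b%:R = r ^+ 2 - a%:R * r by rewrite r_root; ring.
by ring.
Qed.

Lemma char_root_gt (R : realFieldType) (a b : nat) (r : R) :
  (0 < b)%N -> 1 < r -> r ^+ 2 = a%:R * r + b%:R -> a%:R < r.
Proof.
move=> b_gt0 r_gt1 r_root.
have : 0 < b%:R :> R by rewrite ltr0n.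
have -> : b%:R = r * (r - a%:R) by rewrite mulrBr -expr2 r_root; ring.
by rewrite pmulr_rgt0 ?subr_gt0 //; lra.
Qed.

(** Since f[n+1] <= f[n+2] and r - a > 0, the growing part is at most (1 + (r - a)) f[n+2]; cancel
    the positive factor 1 + (r - a). *)
Lemma fibab_ge_expr (R : realFieldType) (a b : nat) (r : R) n :
  (0 < a)%N -> (0 < b)%N -> 1 < r -> r ^+ 2 = a%:R * r + b%:R ->
  r ^+ n <= (fibab a b n.+2)%:R.
Proof.
move=> a_gt0 b_gt0 r_gt1 r_root.
have := char_root_gt b_gt0 r_gt1 r_root.
have := fibab_growing_part n r_root.
have : (fibab a b n.+1)%:R <= (fibab a b n.+2)%:R :> R.
  by rewrite ler_nat fibab_leS.
by nra.
Qed.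

(* With m = r - a, the decaying part of f[n+1] - r f[n] is O(m^n) whereas
   f[n] grows at least like r^n, and 0 < m < r. *)
Lemma cvg_fibab_ratio (R : realType) (a b : nat) (r : R) :
  (0 < a)%N -> (0 < b)%N -> 1 < r -> r ^+ 2 = a%:R * r + b%:R ->
  ((fibab a b n.+1)%:R / (fibab a b n.+2)%:R) @[n --> \oo] --> r^-1.
Proof.
move=> a_gt0 b_gt0 r_gt1 r_root.
have r0 : 0 < r by lra.
have m0 := char_root_gt b_gt0 r_gt1 r_root.
pose m := r - a%:R; have {}m0 : 0 < m by rewrite subr_gt0.
apply/subr_cvg0.
apply: norm_cvg0.
apply: (@squeeze_cvgr _ _ _ _ (cst 0) (fun n => (m / r) ^+ n)); last 2 first.
- exact: cvg_cst.
- apply: cvg_expr; rewrite ger0_norm ?divr_ge0 ?ltW //.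
  by rewrite ltr_pdivrMr // mul1r ltrBlDr ltrDl ltr0n.
apply: nearW => n; rewrite normr_ge0 /=.
have rn0 : 0 < r ^+ n by rewrite exprn_gt0.
have Fr := fibab_ge_expr n a_gt0 b_gt0 r_gt1 r_root.
have := fibab_decaying_part n r_root.
set F2 := (fibab a b n.+2)%:R in Fr *; set F1 := (fibab a b n.+1)%:R => dec.
have F0 : 0 < F2 by apply: lt_le_trans Fr.
have -> : F1 / F2 - r^-1 = (- m) ^+ n * ((r - 1) / (r * F2)).
  have -> : F1 / F2 - r^-1 = - (F2 - r * F1) / (r * F2).
    by field; rewrite !gt_eqF.
  by rewrite dec /m opprB; ring.
rewrite normrM normrX normrN (ger0_norm (ltW m0)) expr_div_n.
(* After cancelling m^n, what is left is (r - 1) / (r F2) <= r^-n, which follows from r^n <= F2. *)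
apply: ler_wpM2l; first exact/exprn_ge0/ltW.
rewrite ger0_norm; last by rewrite divr_ge0 ?subr_ge0 ?mulr_ge0 ?ltW.
rewrite ler_pdivrMr ?mulr_gt0 // mulrCA.
have : 1 <= (r ^+ n)^-1 * F2 by rewrite mulrC ler_pdivlMr // mul1r.
by nra.
Qed.

(** * Limits of the ratios of partial sums *)

Lemma cvg_fibab_inv (R : realType) (a b : nat) :
  (0 < a)%N -> (0 < b)%N -> (fibab a b n.+2)%:R^-1 @[n --> \oo] --> (0 : R).
Proof.
move=> a_gt0 b_gt0.
apply: (@squeeze_cvgr _ _ _ _ (cst 0) (fun n => 2 * harmonic n)); last 2 first.
- exact: cvg_cst.
- by rewrite -[X in _ --> X](mulr0 (2 : R)); apply: cvgMl_tmp; exact: cvg_harmonic.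
apply: nearW => n; have := fibab_linear n.+2 a_gt0 b_gt0.
move: (fibab a b n.+2) => F F0; rewrite invr_ge0 ler0n /= /harmonic /=.
rewrite -[X in X <= _]mul1r ler_pdivrMr ?ltr0n; last by lia.
rewrite mulrAC ler_pdivlMr ?ltr0n // mul1r -natrM ler_nat; lia.
Qed.

Lemma fibab_sumER (R : realFieldType) (a b n : nat) :
  (a%:R + b%:R - 1) * (fibab_sum a b n.+1)%:R =
  (fibab a b n.+2)%:R + b%:R * (fibab a b n.+1)%:R + (a%:R - 2) :> R.
Proof.
have /(congr1 (fun k : nat => k%:R : R)) := fibab_sumE a b n.
by rewrite !(natrD, natrM); lra.
Qed.

Lemma fibab_sum2ER (R : realFieldType) (a b n : nat) :
  (a%:R + b%:R - 1) * (fibab_sum2 a b n.+1)%:R =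
  (fibab_sum a b n.+2)%:R + b%:R * (fibab_sum a b n.+1)%:R
  + (a%:R - 2) * n.+1%:R - 1 :> R.
Proof.
have /(congr1 (fun k : nat => k%:R : R)) := fibab_sum2E a b n.
by rewrite !(natrD, natrM); lra.
Qed.

Lemma fibab_sum_gt0 a b n :
  (0 < a)%N -> (0 < b)%N -> (0 < fibab_sum a b n.+1)%N.
Proof.
by move=> a_gt0 b_gt0; have := fibab_sum_quadratic n.+1 a_gt0 b_gt0; nia.
Qed.

(** Dividing the summed recurrence by f[N+1] shows that S_N / f[N+1] tends to 1 / (r - 1); then
    S_{N+1} / S_N = 1 + f[N+1] / S_N tends to r. *)
Lemma cvg_fibab_sum_ratio (R : realType) (a b : nat) (r : R) :
  (0 < a)%N -> (0 < b)%N -> 1 < r -> r ^+ 2 = a%:R * r + b%:R ->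
  ((fibab_sum a b n.+2)%:R / (fibab_sum a b n.+1)%:R) @[n --> \oo] --> r.
Proof.
move=> a_gt0 b_gt0 r_gt1 r_root.
have r0 : r != 0 by rewrite gt_eqF //; lra.
have r10 : r - 1 != 0 by rewrite gt_eqF //; lra.
have c0 : a%:R + b%:R - 1 != 0 :> R.
  by rewrite gt_eqF // -natrD subr_gt0 ltr1n; lia.
have limS : ((fibab_sum a b n.+1)%:R / (fibab a b n.+2)%:R)
    @[n --> \oo] --> (r - 1)^-1.
  (* The new form is the termwise limit of [fibab_sumER] divided by f[n+2], with 0 for the limit of
     1 / f[n+2]. The two agree since b = r (r - a) gives 1 + b / r = r + 1 - a and a + b - 1 = (r -
     1) (r + 1 - a). *)
  have -> : (r - 1)^-1 =
      (1 + b%:R * r^-1 + (a%:R - 2) * 0) / (a%:R + b%:R - 1).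
    rewrite mulr0 addr0; apply/esym; apply: (canLR (mulfK c0)).
    apply: (@mulfI _ ((r - 1) * r)); first by rewrite mulf_neq0.
    have bE : b%:R = r ^+ 2 - a%:R * r by rewrite r_root; ring.
    by rewrite bE; field; rewrite r0 r10.
  rewrite (_ : (fun n => _) = (fun n =>
      (1 + b%:R * ((fibab a b n.+1)%:R / (fibab a b n.+2)%:R)
      + (a%:R - 2) * (fibab a b n.+2)%:R^-1) / (a%:R + b%:R - 1))); last first.
    apply/funext => n.
    have F0 : (fibab a b n.+2)%:R != 0 :> R.
      by rewrite pnatr_eq0; have := fibab_linear n.+2 a_gt0 b_gt0; lia.
    apply: (canRL (mulfK c0)).
    rewrite mulrAC [_ * (_ + _ - 1)]mulrC fibab_sumER.
    by field.
  apply: cvgMr_tmp; apply: cvgD; last by apply: cvgMl_tmp; exact: cvg_fibab_inv.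
  by apply: cvgD; [exact: cvg_cst|apply: cvgMl_tmp; exact: cvg_fibab_ratio].
have -> : r = 1 + (r - 1)^-1^-1 by rewrite invrK; ring.
rewrite (_ : (fun n => _) = (fun n =>
    1 + ((fibab_sum a b n.+1)%:R / (fibab a b n.+2)%:R)^-1)); last first.
  apply/funext => n; rewrite fibab_sumS natrD mulrDl divff ?invf_div //.
  by rewrite pnatr_eq0 -lt0n fibab_sum_gt0.
apply: cvgD; first exact: cvg_cst.
by apply: cvgV => //; rewrite invr_neq0.
Qed.

Lemma cvg_fibab_mean (R : realType) (a b : nat) (r : R) :
  (0 < a)%N -> (0 < b)%N -> 1 < r -> r ^+ 2 = a%:R * r + b%:R ->
  ((fibab_sum2 a b n.+1)%:R / (fibab_sum a b n.+1)%:R)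
    @[n --> \oo] --> r / (r - 1).
Proof.
move=> a_gt0 b_gt0 r_gt1 r_root.
have r10 : r - 1 != 0 by rewrite gt_eqF //; lra.
have c0 : a%:R + b%:R - 1 != 0 :> R.
  by rewrite gt_eqF // -natrD subr_gt0 ltr1n; lia.
have S_gt0 n : 0 < (fibab_sum a b n.+1)%:R :> R by rewrite ltr0n fibab_sum_gt0.
(* The linear term of [fibab_sum2ER] vanishes in the limit after division by the sum. *)
have lim1 : (n.+1%:R / (fibab_sum a b n.+1)%:R) @[n --> \oo] --> (0 : R).
  apply: (@squeeze_cvgr _ _ _ _ (cst 0) (fun n => 4 * harmonic n)); last 2 first.
  - exact: cvg_cst.
  - by rewrite -[X in _ --> X](mulr0 (4 : R)); apply: cvgMl_tmp; exact: cvg_harmonic.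
  apply: nearW => n; rewrite divr_ge0 ?ler0n //= /harmonic /=.
  rewrite ler_pdivrMr // mulrAC ler_pdivlMr ?ltr0n // -!natrM ler_nat.
  have := fibab_sum_quadratic n.+1 a_gt0 b_gt0; nia.
have lim2 : (fibab_sum a b n.+1)%:R^-1 @[n --> \oo] --> (0 : R).
  apply: (@squeeze_cvgr _ _ _ _ (cst 0)
    (fun n => n.+1%:R / (fibab_sum a b n.+1)%:R)) => //; last exact: cvg_cst.
  apply: nearW => n; have /ltW := S_gt0 n; rewrite -invr_ge0 => Sinv_ge0.
  by rewrite Sinv_ge0 /= ler_peMl ?ler1n.
(* The root equation gives (r + b) (r - 1) = r (a + b - 1); the zeros stand for the limits [lim1]
   and [lim2]. *)
have -> : r / (r - 1) =
    (r + b%:R + (a%:R - 2) * 0 - 0) / (a%:R + b%:R - 1).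
  rewrite mulr0 addr0 subr0; apply/esym; apply: (canLR (mulfK c0)).
  apply: (@mulfI _ (r - 1)) => //.
  have bE : b%:R = r ^+ 2 - a%:R * r by rewrite r_root; ring.
  by rewrite bE; field.
rewrite (_ : (fun n => _) = (fun n =>
    ((fibab_sum a b n.+2)%:R / (fibab_sum a b n.+1)%:R + b%:R
    + (a%:R - 2) * (n.+1%:R / (fibab_sum a b n.+1)%:R)
    - (fibab_sum a b n.+1)%:R^-1) / (a%:R + b%:R - 1))); last first.
  apply/funext => n; have S0 := lt0r_neq0 (S_gt0 n).
  apply: (canRL (mulfK c0)).
  rewrite mulrAC [_ * (_ + _ - 1)]mulrC fibab_sum2ER.
  by field.
apply: cvgMr_tmp; apply: cvgB => //; apply: cvgD; last exact: cvgMl_tmp.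
by apply: cvgD; [exact: cvg_fibab_sum_ratio|exact: cvg_cst].
Qed.

(** * The expectation and its limit *)

(** The fibres of X over 1, ..., N partition the space, so the integral of X splits into the sum of
    n P(X = n), whose numerator is the sum in [fibab_weighted_sum]. *)
Lemma expectation_inverse_fib (R : realType) (a b N : nat)
    (d : measure_display) (T : measurableType d) (P : probability T R)
    (X : {RV P >-> R}) :
  inverse_fib_rv a b N X ->
  ('E_P[X] = ((fibab_sum2 a b N)%:R / (fibab_sum a b N)%:R)%:E)%E.
Proof.
move=> [X_val X_law]; rewrite expectation_def.
have mX n : measurable (X @^-1` [set n%:R]) by exact: measurable_funPTI.
have -> : [set: T] =
    \big[setU/set0]_(n <- index_iota 1 N.+1) X @^-1` [set n%:R].
  rewrite -bigcup_seq; apply/seteqP; split => // t _.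
  have [n nN Xt] := X_val t; exists n => //=.
  by rewrite mem_index_iota ltnS.
rewrite ge0_integral_bigsetU //=; first last.
- move=> t _; have [n _ ->] := X_val t; by rewrite lee_fin.
- exact/measurable_EFinP/measurable_funTS.
- by move=> i j _ _ [t [/= -> /eqP]]; rewrite eqr_nat => /eqP.
- exact: iota_uniq.
rewrite -fibab_weighted_sum natr_sum mulr_suml -sumEFin.
rewrite !big_nat; apply: eq_bigr => n nN.
rewrite (eq_integral (fun=> n%:R%:E)); last by move=> t; rewrite inE /= => ->.
rewrite integral_cst // natrM -mulrA EFinM.
by congr (_ * _)%E; exact: X_law.
Qed.

Lemma cvg_expectation_inverse_fib (R : realType) (a b : nat) (r : R)
    (d : nat -> measure_display) (T : forall N, measurableType (d N))
    (P : forall N, probability (T N) R) (X : forall N, {RV (P N) >-> R}) :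
  (0 < a)%N -> (0 < b)%N -> 1 < r -> r ^+ 2 = a%:R * r + b%:R ->
  (forall N, (0 < N)%N -> inverse_fib_rv a b N (X N)) ->
  ('E_(P N)[X N])%E @[N --> \oo] --> (r / (r - 1))%:E.
Proof.
(* The law is prescribed for N > 0 only, so the sequence is shifted by one before the closed form is
   used. *)
move=> a_gt0 b_gt0 r_gt1 r_root hX; rewrite -cvg_shiftS /=.
rewrite (_ : (fun n => _) = (fun n =>
    ((fibab_sum2 a b n.+1)%:R / (fibab_sum a b n.+1)%:R)%:E)); last first.
  by apply/funext => n; rewrite (expectation_inverse_fib (hX n.+1 _)).
by apply: cvg_EFin; [exact: nearW|exact: cvg_fibab_mean].
Qed.

(** * The dominant root and its minimum, the golden ratio *)

(** The larger root of x^2 = a x + b, by the quadratic formula. *)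
Definition char_root (R : rcfType) (a b : nat) : R :=
  (a%:R + Num.sqrt (a%:R ^+ 2 + 4 * b%:R)) / 2.

Lemma char_rootP (R : rcfType) (a b : nat) :
  char_root R a b ^+ 2 = a%:R * char_root R a b + b%:R.
Proof.
rewrite /char_root; set s := Num.sqrt _.
have s2 : s ^+ 2 = a%:R ^+ 2 + 4 * b%:R.
  by rewrite sqr_sqrtr // addr_ge0 ?sqr_ge0 ?mulr_ge0.
have -> : b%:R = (s ^+ 2 - a%:R ^+ 2) / 4 by rewrite s2; field.
by field.
Qed.

Lemma char_root11 (R : realType) : char_root R 1 1 = golden_ratio R.
Proof. by rewrite /char_root; congr ((_ + Num.sqrt _) / _); ring. Qed.

(** Both a and the discriminant a^2 + 4 b are smallest at a = b = 1. *)
Lemma golden_ratio_le_char_root (R : realType) (a b : nat) :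
  (0 < a)%N -> (0 < b)%N -> golden_ratio R <= char_root R a b.
Proof.
move=> a_gt0 b_gt0.
have a1 : 1 <= a%:R :> R by rewrite ler1n.
have b1 : 1 <= b%:R :> R by rewrite ler1n.
rewrite -char_root11 /char_root ler_pM2r ?invr_gt0 //.
apply: lerD => //; apply: ler_wsqrtr; nra.
Qed.

Lemma golden_ratio_gt1 (R : realType) : 1 < golden_ratio R.
Proof.
rewrite /golden_ratio ltr_pdivlMr // mul1r ltrD2l -[X in X < _]sqrtr1.
by rewrite ltr_sqrt ?ltr1n.
Qed.

(** From g^2 = g + 1 follows (g + 1) (g - 1) = g^2 - 1 = g. *)
Lemma golden_ratioE (R : realType) :
  golden_ratio R / (golden_ratio R - 1) = golden_ratio R + 1.
Proof.
have := char_rootP R 1 1; rewrite char_root11.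
have := golden_ratio_gt1 R; set g := golden_ratio R => g1 g2.
have g10 : g - 1 != 0 by rewrite gt_eqF //; lra.
by apply: (canLR (mulfK g10)); nra.
Qed.

Theorem theorem4p5 (R : realType)
    (d : nat -> nat -> nat -> measure_display)
    (T : forall a b N : nat, measurableType (d a b N))
    (P : forall a b N : nat, probability (T a b N) R)
    (X : forall a b N : nat, {RV (P a b N) >-> R})
    (hX : forall a b N : nat, (0 < a)%N -> (0 < b)%N -> (0 < N)%N ->
       inverse_fib_rv a b N (X a b N)) :
  let EX (a b N : nat) : \bar R := ('E_(P a b N)[X a b N])%E in
  [/\ forall a b : nat, (0 < a)%N -> (0 < b)%N -> cvgn (EX a b),
      is_maximum
        [set l : \bar R | exists a b : nat,
           [/\ (0 < a)%N, (0 < b)%N & l = limn (EX a b)]]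
        (limn (EX 1%N 1%N))
    & limn (EX 1%N 1%N) = (golden_ratio R + 1)%:E].
Proof.
move=> EX.
have root_gt1 a b : (0 < a)%N -> (0 < b)%N -> 1 < char_root R a b.
  move=> a_gt0 b_gt0; apply: lt_le_trans (golden_ratio_gt1 R) _.
  exact: golden_ratio_le_char_root.
have cvgEX a b : (0 < a)%N -> (0 < b)%N ->
    EX a b @ \oo --> (char_root R a b / (char_root R a b - 1))%:E.
  move=> a_gt0 b_gt0; have := char_rootP R a b.
  move=> /(cvg_expectation_inverse_fib a_gt0 b_gt0 (root_gt1 _ _ a_gt0 b_gt0)).
  by apply=> N; exact: hX.
have lim11 : limn (EX 1%N 1%N) = (golden_ratio R + 1)%:E.
  by rewrite (cvg_lim _ (cvgEX _ _ _ _)) // char_root11 golden_ratioE.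
split=> //; first by move=> a b a0 b0; apply/cvg_ex; eexists; exact: cvgEX.
split; first by exists 1%N, 1%N.
move=> _ [a [b [a0 b0 ->]]]; rewrite lim11 (cvg_lim _ (cvgEX _ _ a0 b0)) //.
(* Writing the bound as g / (g - 1) makes both sides values of x / (x - 1); clearing the positive
   denominators reduces the comparison to g <= r. *)
rewrite lee_fin -golden_ratioE.
have := golden_ratio_le_char_root R a0 b0; have := golden_ratio_gt1 R.
set g := golden_ratio R; set r := char_root R a b => g1 gr.
rewrite ler_pdivrMr ?subr_gt0 1?(lt_le_trans g1) //.
rewrite mulrAC ler_pdivlMr ?subr_gt0 //; nra.
Qed.
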